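(* Let $K$ be a field of characteristic zero and let $P(\mathrm{sl}_2(K))$ be the Poisson enveloping algebra of $\mathrm{sl}_2(K)$ with the standard Casimir element $C=\tfrac12h^2+2ef$. Then the quotient Poisson algebra $P(\mathrm{sl}_2(K))/(C-\lambda)$ is central and simple for any $0\neq\lambda\in K$.
   Context: $\mathrm{sl}_2(K)$ has its standard basis $e,f,h$ with $[h,e]=2e$, $[h,f]=-2f$, $[e,f]=h$. The Poisson enveloping algebra $P(\mathrm{sl}_2(K))$ is the polynomial algebra $K[e,f,h]$ with the unique Poisson bracket such that $\{h,e\}=2e$, $\{h,f\}=-2f$, $\{e,f\}=h$. The element $C$ satisfies $\{C,g\}=0$ for all $g$, so the ideal $(C-\lambda)$ of $K[e,f,h]$ generated by $C-\lambda$ is a Poisson ideal. A Poisson algebra $P$ over $K$ is central if $Z(P)=\{c\in P:\{c,g\}=0\ \text{for all }g\in P\}$ equals $K$, and simple if the only ideals $I$ of the commutative associative algebra $P$ with $\{P,I\}\subseteq I$ are $0$ and $P$. *)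

(* Defs.v *)
From HB Require Import structures.
From mathcomp Require Import all_boot all_algebra.
From mathcomp Require Import boolp mpoly ring.

Set Implicit Arguments.
Unset Strict Implicit.
Unset Printing Implicit Defensive.

Import GRing.Theory.
Local Open Scope ring_scope.
Local Open Scope quotient_scope.

HB.mixin Record isPoisson (K : fieldType) P of GRing.ComAlgebra K P := {
  pbracket : P -> P -> P;
  pbracket_linearl : forall q, linear (pbracket^~ q);
  pbracket_linearr : forall p, linear (pbracket p);
  pbracketxx : forall p, pbracket p p = 0;
  pbracketJ : forall p q r,
    pbracket p (pbracket q r) + pbracket q (pbracket r p)
      + pbracket r (pbracket p q) = 0;
  pbracketM : forall p q r,
    pbracket p (q * r) = pbracket p q * r + q * pbracket p r
}.

#[short(type="poissonAlgType")]
HB.structure Definition PoissonAlg (K : fieldType) :=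
  {P of GRing.ComAlgebra K P & isPoisson K P}.

Section PoissonTheory.
Variables (K : fieldType) (P : poissonAlgType K).
Implicit Types (k : K) (p q r : P).

Lemma pbracketDl p q r : pbracket (p + q) r = pbracket p r + pbracket q r.
Proof. by have := pbracket_linearl r 1 p q; rewrite !scale1r. Qed.

Lemma pbracketDr p q r : pbracket p (q + r) = pbracket p q + pbracket p r.
Proof. by have := pbracket_linearr p 1 q r; rewrite !scale1r. Qed.

Lemma pbracketBl p q r : pbracket (p - q) r = pbracket p r - pbracket q r.
Proof. by apply: (addIr (pbracket q r)); rewrite -pbracketDl !subrK. Qed.

Lemma pbracketBr p q r : pbracket p (q - r) = pbracket p q - pbracket p r.
Proof. by apply: (addIr (pbracket p r)); rewrite -pbracketDr !subrK. Qed.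

Lemma pbracketC p q : pbracket p q = - pbracket q p.
Proof.
apply/eqP; rewrite -addr_eq0; apply/eqP.
have := pbracketxx (p + q).
by rewrite pbracketDl !pbracketDr !pbracketxx add0r addr0.
Qed.

Lemma pbracketA p k : pbracket p k%:A = 0.
Proof.
have p10 : pbracket p 1 = 0.
  have := pbracketM p 1 1; rewrite !mulr1 mul1r => p11.
  by apply: (addrI (pbracket p 1)); rewrite addr0 -p11.
by rewrite -[k%:A]addr0 pbracket_linearr p10 scaler0 add0r -[X in pbracket p X](subrr p)
  pbracketBr !subrr.
Qed.
End PoissonTheory.

Section CentralSimple.
Variables (K : fieldType) (P : poissonAlgType K).

Definition poisson_center (c : P) : Prop := forall g : P, pbracket c g = 0.

Definition poisson_central : Prop :=
  forall c : P, poisson_center c <-> exists k : K, c = k%:A.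

(* Unlike [idealr], these ideals need be neither proper nor decidable. *)
Definition is_ideal (I : P -> Prop) : Prop :=
  [/\ I 0, forall x y, I x -> I y -> I (x + y)
    & forall a x, I x -> I (a * x)].

Definition is_poisson_ideal (I : P -> Prop) : Prop :=
  is_ideal I /\ forall a x, I x -> I (pbracket a x).

Definition poisson_simple : Prop :=
  forall I : P -> Prop, is_poisson_ideal I ->
    (forall x, I x <-> x = 0) \/ (forall x, I x).
End CentralSimple.

Arguments poisson_central {K} P.
Arguments poisson_simple {K} P.

HB.mixin Record isPoissonClosed (K : fieldType) (P : poissonAlgType K)
    (S : P -> bool) := {
  poisson_closed_subproof : forall a u, S u -> S (pbracket a u)
}.

#[short(type="poissonIdeal")]
HB.structure Definition PoissonIdeal (K : fieldType) (P : poissonAlgType K) :=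
  {S of Idealr P S & isPoissonClosed K P S}.

Section PoissonQuotient.
Variables (K : fieldType) (P : poissonAlgType K) (I : poissonIdeal P).
Local Notation Q := {ideal_quot I}.

Definition quot_scale (k : K) (x : Q) : Q := \pi_Q k%:A * x.

Fact quot_scaleA k l x : quot_scale k (quot_scale l x) = quot_scale (k * l) x.
Proof. by rewrite /quot_scale mulrA -rmorphM /= -scalerAl mul1r scalerA. Qed.

Fact quot_scale1 : left_id 1 quot_scale.
Proof. by move=> x; rewrite /quot_scale scale1r rmorph1 mul1r. Qed.

Fact quot_scaleDr : right_distributive quot_scale +%R.
Proof. by move=> k x y; rewrite /quot_scale mulrDr. Qed.

Fact quot_scaleDl x : {morph quot_scale^~ x : k l / k + l}.
Proof. by move=> k l; rewrite /quot_scale scalerDl rmorphD mulrDl. Qed.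

HB.instance Definition _ := GRing.Zmodule_isLmodule.Build K Q
  quot_scaleA quot_scale1 quot_scaleDr quot_scaleDl.

Fact quot_scaleAl (k : K) (x y : Q) : k *: (x * y) = k *: x * y.
Proof. exact: mulrA. Qed.

HB.instance Definition _ := GRing.Lmodule_isLalgebra.Build K Q quot_scaleAl.
HB.instance Definition _ := GRing.Lalgebra_isComAlgebra.Build K Q.

Lemma quot_piZ (k : K) (p : P) : \pi_Q (k *: p) = k *: \pi_Q p.
Proof. by rewrite -[k *: \pi_Q p]rmorphM /= -scalerAl mul1r. Qed.

Definition quot_pbracket (x y : Q) : Q := \pi_Q (pbracket (repr x) (repr y)).

Lemma quot_pi_pbracket p q :
  \pi_Q (pbracket p q) = quot_pbracket (\pi_Q p) (\pi_Q q).
Proof.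
pose p' := repr (\pi_Q p); pose q' := repr (\pi_Q q).
have Ip : p - p' \in (I : pred P).
  by rewrite Quotient.idealrBE; apply/eqP; rewrite reprK.
have Iq : q - q' \in (I : pred P).
  by rewrite Quotient.idealrBE; apply/eqP; rewrite reprK.
apply/eqP; rewrite -Quotient.idealrBE -/p' -/q'.
have -> : pbracket p q - pbracket p' q'
    = pbracket p (q - q') - pbracket q' (p - p').
  by rewrite -[in RHS]pbracketC pbracketBr pbracketBl addrA subrK.
by rewrite rpredB //; apply: poisson_closed_subproof.
Qed.

Fact quot_pbracket_linearl y : linear (quot_pbracket^~ y).
Proof.
move=> k x z; rewrite -[x]reprK -[y]reprK -[z]reprK -quot_piZ -rmorphD /=.
by rewrite -!quot_pi_pbracket pbracket_linearl rmorphD /= quot_piZ.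
Qed.

Fact quot_pbracket_linearr x : linear (quot_pbracket x).
Proof.
move=> k y z; rewrite -[x]reprK -[y]reprK -[z]reprK -quot_piZ -rmorphD /=.
by rewrite -!quot_pi_pbracket pbracket_linearr rmorphD /= quot_piZ.
Qed.

Fact quot_pbracketxx x : quot_pbracket x x = 0.
Proof. by rewrite -[x]reprK -quot_pi_pbracket pbracketxx rmorph0. Qed.

Fact quot_pbracketJ x y z :
  quot_pbracket x (quot_pbracket y z) + quot_pbracket y (quot_pbracket z x)
    + quot_pbracket z (quot_pbracket x y) = 0.
Proof.
have /(congr1 \pi_Q) := pbracketJ (repr x) (repr y) (repr z).
by rewrite !rmorphD rmorph0 /= !quot_pi_pbracket !reprK.
Qed.

Fact quot_pbracketM x y z :
  quot_pbracket x (y * z) = quot_pbracket x y * z + y * quot_pbracket x z.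
Proof.
rewrite -[x]reprK -[y]reprK -[z]reprK -rmorphM /= -!quot_pi_pbracket pbracketM.
by rewrite rmorphD !rmorphM.
Qed.

HB.instance Definition _ := isPoisson.Build K Q
  quot_pbracket_linearl quot_pbracket_linearr quot_pbracketxx
  quot_pbracketJ quot_pbracketM.

Lemma pi_pbracket : {morph \pi_Q : p q / pbracket p q >-> pbracket p q}.
Proof. exact: quot_pi_pbracket. Qed.
End PoissonQuotient.

Section Jacobiator.
Variables (K : fieldType) (A : comAlgType K) (br : A -> A -> A).
Hypothesis brlinl : forall q, linear (br^~ q).
Hypothesis brC : forall p q, br p q = - br q p.
Hypothesis brM : forall p q r, br p (q * r) = br p q * r + q * br p r.
Implicit Types p q r : A.

Definition jacobiator p q r := br p (br q r) + br q (br r p) + br r (br p q).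

Lemma jacobiatorC p q r : jacobiator p q r = jacobiator q r p.
Proof. by rewrite /jacobiator -addrA addrC. Qed.

Let brlinr p : linear (br p).
Proof. by move=> k q r; rewrite !(brC p) brlinl opprD -scalerN. Qed.

Let brD p q r : br p (q + r) = br p q + br p r.
Proof. by have := brlinr p 1 q r; rewrite !scale1r. Qed.

Let brMl p q r : br (p * q) r = br p r * q + p * br q r.
Proof. rewrite (brC (p * q)) brM (brC r p) (brC r q); ring. Qed.

Lemma jacobiator_linear q r : linear (fun p => jacobiator p q r).
Proof.
move=> k p p'; rewrite /jacobiator !(brlinl, brlinr) !scalerDr.
by rewrite [k *: _ + _ + (_ + _)]addrACA [LHS]addrACA.
Qed.

Lemma jacobiatorM q r p p' :
  jacobiator (p * p') q r = jacobiator p q r * p' + p * jacobiator p' q r.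
Proof.
rewrite /jacobiator !(brMl, brM) !brD !(brMl, brM).
rewrite (brC q p) (brC q p') (brC r p) (brC r p'); ring.
Qed.
End Jacobiator.

Lemma mpoly_derivation_eq0 (K : fieldType) n (D : {mpoly K[n]} -> {mpoly K[n]}) :
    linear D -> (forall p q, D (p * q) = D p * q + p * D q) ->
  (forall i, D 'X_i = 0) -> forall p, D p = 0.
Proof.
move=> linD DM DX; have D0 : D 0 = 0.
  have := linD 1 0 0; rewrite !scale1r addr0 => D0D.
  by apply: (addrI (D 0)); rewrite addr0 -D0D.
have D1 : D 1 = 0.
  have := DM 1 1; rewrite !mulr1 mul1r => D1D.
  by apply: (addrI (D 1)); rewrite addr0 -D1D.
have DXn (m : 'X_{1..n}) : D 'X_[m] = 0.
  rewrite mpolyXE_id; elim/big_ind: _ => // [p q Dp Dq|i _].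
    by rewrite DM Dp Dq mul0r mulr0 addr0.
  elim: (m i) => [|k IHk]; first by rewrite expr0.
  by rewrite exprS DM DX IHk mul0r mulr0 addr0.
elim/mpolyind=> // c m p _ _ Dp.
by rewrite linD DXn Dp scaler0 addr0.
Qed.

Definition Psl2 (K : fieldType) : Type := {mpoly K[3]}.

HB.instance Definition _ (K : fieldType) := GRing.ComAlgebra.on (Psl2 K).

Section Sl2.
Variable K : fieldType.
Implicit Types (p q r : Psl2 K).

Definition sl2e : Psl2 K := 'X_(0 : 'I_3).
Definition sl2f : Psl2 K := 'X_(1 : 'I_3).
Definition sl2h : Psl2 K := 'X_(2 : 'I_3).

Local Notation de p := (mderiv (0 : 'I_3) p).
Local Notation df p := (mderiv (1 : 'I_3) p).
Local Notation dh p := (mderiv (2 : 'I_3) p).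

(* The biderivation of K[e,f,h] determined by the values of the bracket on
   the generators: each pair x, y contributes
   (d_x p * d_y q - d_y p * d_x q) * [x, y]. *)
Definition sl2_pbracket p q : Psl2 K :=
  (de p * df q - df p * de q) * sl2h
  + (dh p * de q - de p * dh q) * (2 * sl2e)
  - (dh p * df q - df p * dh q) * (2 * sl2f).

Let mderiv_gen (i j : 'I_3) : mderiv i ('X_j : {mpoly K[3]}) = (i == j)%:R.
Proof.
rewrite mderivX mnm1E eq_sym; case: eqP => [->|_]; last by rewrite scale0r.
by rewrite scale1r -mpolyX0; congr mpolyX; apply/mnmP=> k; rewrite mnmBE subnn mnm0E.
Qed.

Fact sl2_pbracket_linearl q : linear (sl2_pbracket^~ q).
Proof.
move=> k p r; rewrite /sl2_pbracket !linearP /= -!mul_mpolyC; ring.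
Qed.

Fact sl2_pbracket_linearr p : linear (sl2_pbracket p).
Proof.
move=> k q r; rewrite /sl2_pbracket !linearP /= -!mul_mpolyC; ring.
Qed.

Fact sl2_pbracketxx p : sl2_pbracket p p = 0.
Proof. rewrite /sl2_pbracket; ring. Qed.

Fact sl2_pbracketM p q r :
  sl2_pbracket p (q * r) = sl2_pbracket p q * r + q * sl2_pbracket p r.
Proof. rewrite /sl2_pbracket !mderivM; ring. Qed.

Fact sl2_pbracket_he : sl2_pbracket sl2h sl2e = 2 * sl2e.
Proof. by rewrite /sl2_pbracket !mderiv_gen /=; ring. Qed.

Fact sl2_pbracket_hf : sl2_pbracket sl2h sl2f = - (2 * sl2f).
Proof. by rewrite /sl2_pbracket !mderiv_gen /=; ring. Qed.

Fact sl2_pbracket_ef : sl2_pbracket sl2e sl2f = sl2h.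
Proof. by rewrite /sl2_pbracket !mderiv_gen /=; ring. Qed.

Let sl2_pbracketC p q : sl2_pbracket p q = - sl2_pbracket q p.
Proof. by rewrite /sl2_pbracket; ring. Qed.

Let sl2_pbracket0 p : sl2_pbracket p 0 = 0.
Proof. by rewrite /sl2_pbracket !linear0; ring. Qed.

Let sl2_pbracketN p q : sl2_pbracket p (- q) = - sl2_pbracket p q.
Proof. by rewrite /sl2_pbracket !linearN /=; ring. Qed.

Let sl2_pbracket2 p q : sl2_pbracket p (2 * q) = 2 * sl2_pbracket p q.
Proof. by rewrite /sl2_pbracket !mulr_natl !linearMn; ring. Qed.

Let genE (l : 'I_3) : [\/ 'X_l = sl2e, 'X_l = sl2f | 'X_l = sl2h].
Proof.
rewrite /sl2e /sl2f /sl2h; case: l => [[|[|[|]]] //= l3].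
- by apply: Or31; congr 'X_(_); apply: val_inj.
- by apply: Or32; congr 'X_(_); apply: val_inj.
- by apply: Or33; congr 'X_(_); apply: val_inj.
Qed.

Let jac0 q r : (forall i : 'I_3, jacobiator sl2_pbracket 'X_i q r = 0) ->
  forall p, jacobiator sl2_pbracket p q r = 0.
Proof.
apply: (@mpoly_derivation_eq0 K 3 (fun p => jacobiator sl2_pbracket p q r)).
  exact: (jacobiator_linear sl2_pbracket_linearl sl2_pbracketC).
exact: (jacobiatorM sl2_pbracket_linearl sl2_pbracketC sl2_pbracketM).
Qed.

Fact sl2_pbracketJ p q r :
  sl2_pbracket p (sl2_pbracket q r) + sl2_pbracket q (sl2_pbracket r p)
    + sl2_pbracket r (sl2_pbracket p q) = 0.
Proof.
rewrite -/(jacobiator sl2_pbracket p q r); apply: jac0 p => i; rewrite jacobiatorC.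
apply: jac0 q => j; rewrite jacobiatorC; apply: jac0 r => k.
have table := (sl2_pbracketxx, sl2_pbracket_he, sl2_pbracket_hf,
  sl2_pbracket_ef, sl2_pbracketC sl2e sl2h, sl2_pbracketC sl2f sl2h,
  sl2_pbracketC sl2f sl2e, sl2_pbracketN, sl2_pbracket0, sl2_pbracket2).
by case: (genE i) => ->; case: (genE j) => ->; case: (genE k) => ->;
  rewrite /jacobiator !table; ring.
Qed.

HB.instance Definition _ := isPoisson.Build K (Psl2 K)
  sl2_pbracket_linearl sl2_pbracket_linearr sl2_pbracketxx
  sl2_pbracketJ sl2_pbracketM.

Lemma sl2_pbracket_unique (br : Psl2 K -> Psl2 K -> Psl2 K) :
    (forall q, linear (br^~ q)) -> (forall p, linear (br p)) ->
    (forall p, br p p = 0) ->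
    (forall p q r, br p (q * r) = br p q * r + q * br p r) ->
    br sl2h sl2e = 2 * sl2e -> br sl2h sl2f = - (2 * sl2f) ->
    br sl2e sl2f = sl2h ->
  forall p q, br p q = pbracket p q.
Proof.
move=> linl linr brxx brM he hf ef.
have brDl p q r : br (p + q) r = br p r + br q r.
  by have := linl r 1 p q; rewrite !scale1r.
have brDr p q r : br p (q + r) = br p q + br p r.
  by have := linr p 1 q r; rewrite !scale1r.
have brC p q : br p q = - br q p.
  apply/eqP; rewrite -addr_eq0; apply/eqP.
  by have := brxx (p + q); rewrite brDl !brDr !brxx add0r addr0.
have ext q : (forall i : 'I_3, br q 'X_i = pbracket q ('X_i : Psl2 K)) ->
    forall p, br q p = pbracket q p.
  move=> eqX p; apply/eqP; rewrite -subr_eq0; apply/eqP; move: p.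
  apply: (@mpoly_derivation_eq0 K 3 (fun p => br q p - pbracket q p)).
  - move=> k p p'.
    by rewrite linr pbracket_linearr (scalerBr k (br q p)) opprD addrACA.
  - move=> p p'; rewrite brM pbracketM. ring.
  - by move=> i; rewrite eqX subrr.
move=> p; apply: (ext) => i; rewrite brC [RHS]pbracketC; congr (- _).
apply: ext p => j; rewrite /pbracket /=.
case: (genE i) => ->; case: (genE j) => ->;
  rewrite ?(brxx, he, hf, ef, sl2_pbracketxx, sl2_pbracket_he,
    sl2_pbracket_hf, sl2_pbracket_ef) //; 
  by rewrite brC sl2_pbracketC ?(he, hf, ef, sl2_pbracket_he,
    sl2_pbracket_hf, sl2_pbracket_ef).
Qed.

Definition sl2_casimir : Psl2 K := 2^-1 *: sl2h ^+ 2 + 2 *: (sl2e * sl2f).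

Hypothesis charK : [pchar K] =i pred0.

Let two_neq0 : 2 != 0 :> K.
Proof. by have /pcharf0P-> := charK. Qed.

Lemma sl2_casimir_central g : pbracket sl2_casimir g = 0.
Proof.
have dC (i : 'I_3) : mderiv i sl2_casimir
    = (i == 2)%:R * sl2h + 2 * (i == 0)%:R * sl2f + 2 * (i == 1)%:R * sl2e.
  rewrite /sl2_casimir mderivD !mderivZ expr2 !mderivM !mderiv_gen.
  rewrite [_ * sl2h]mulrC -mulr2n -scaler_nat scalerA mulVf // scale1r.
  by rewrite scaler_nat; ring.
by rewrite /pbracket /= /sl2_pbracket !dC /=; ring.
Qed.
End Sl2.

Arguments sl2_casimir {K}.

(* The argument charK makes the ideal proper: in characteristic 2 the
   conventions 2^-1 = 0 and 2 = 0 would turn C into 0. *)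
Definition casimir_ideal (K : fieldType) (charK : [pchar K] =i pred0) (lam : K)
  : {pred Psl2 K} := fun p => `[< exists q, p = q * (sl2_casimir - lam%:A) >].

Section CasimirQuotient.
Variables (K : fieldType) (charK : [pchar K] =i pred0) (lam : K).
Local Notation I := (casimir_ideal charK lam).

Let casimir_idealP (p : Psl2 K) :
  reflect (exists q, p = q * (sl2_casimir - lam%:A)) (p \in I).
Proof. exact: asboolP. Qed.

Fact casimir_ideal_closed : idealr_closed I.
Proof.
split.
- by apply/casimir_idealP; exists 0; rewrite mul0r.
- apply/casimir_idealP => -[q].
  pose v (i : 'I_3) : K := [:: lam / 2; 1; 0]`_i.
  have [ve vf vh] : [/\ v 0 = lam / 2, v 1 = 1 & v 2 = 0] by [].
  rewrite /sl2_casimir /sl2e /sl2f /sl2h expr2.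
  move/(congr1 (meval v)).
  rewrite meval1 mevalM mevalB mevalD !mevalZ !mevalM !mevalXU meval1 ve vf vh.
  rewrite !mulr0 add0r !mulr1 [2 * _]mulrC divfK.
    by rewrite subrr mulr0 => /eqP; rewrite oner_eq0.
  by have /pcharf0P-> := charK.
- move=> a _ _ /casimir_idealP[p ->] /casimir_idealP[q ->].
  by apply/casimir_idealP; exists (a * p + q); rewrite mulrDl mulrA.
Qed.

HB.instance Definition _ := isIdealr.Build (Psl2 K) I casimir_ideal_closed.

Fact casimir_ideal_pclosed a u : I u -> I (pbracket a u).
Proof.
move=> /casimir_idealP[q ->]; apply/casimir_idealP; exists (pbracket a q).
rewrite pbracketM pbracketBr (pbracketC a sl2_casimir) sl2_casimir_central //.
by rewrite pbracketA oppr0 addr0 mulr0 addr0.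
Qed.

HB.instance Definition _ :=
  isPoissonClosed.Build K (Psl2 K) I casimir_ideal_pclosed.
End CasimirQuotient.

(* Main.v *)
Require Import Defs.
From mathcomp Require Import all_boot all_algebra.
From mathcomp Require Import boolp mpoly ring zify.

Set Implicit Arguments.
Unset Strict Implicit.
Unset Printing Implicit Defensive.

Import GRing.Theory.
Local Open Scope ring_scope.
Local Open Scope quotient_scope.

(** Write [Q] for the quotient, [g = lam/2 - X^2/4] for the polynomial with
    [ef = g(h)] in [Q], and [B] for the commutative polynomial ring [K[h][e]].
    The proof works inside [B], on which the bracket is transparent: [{h, .}]
    is [2 e d/de], with eigenvalue [2n] on [a(h) e^n], while [{a(h), e}] is
    [2 a'(h) e].  Three facts allow this: [B] embeds in [Q]
    ([quot_borel_inj]), every element of [Q] is carried into [B] by a power of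
    [e], because [ef] lies in [K[h]] ([clear_denominators]), and no information
    is lost in doing so, because [e] is not a zero divisor ([quot_e_regular]).

    Centre.  If [c] is central and [e^n c] lies in [B], then [e^n c] has weight
    [2n], so it is [a(h) e^n] and [c = a(h)].  Then [0 = {c, e} = 2 a'(h) e]
    gives [a' = 0], and [a] is constant since the characteristic is zero.

    Simplicity.  A nonzero Poisson ideal [I] meets [B].  Applying
    [2n - {h, .}] to an element of degree [n] in [e] kills its leading term, so
    a nonzero element of least degree in [I] is some [a(h) e^n], and its
    product with [f^n] is a nonzero polynomial in [h] ([ideal_hpoly]).  Hence
    the [p] with [p(h)] in [I] form a nonzero ideal of [K[X]], and bracketing
    with [e] and then [f] shows that it is stable under [p |-> g p'] and
    [p |-> (g p')'] ([ideal_ef_deriv]).  Its generator divides both; as [g] is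
    squarefree, which is where [lam != 0] enters, this forces the generator to
    be constant ([efpoly_stable_const]). *)

(** * Polynomials in characteristic zero *)

Section CharZeroPoly.
Variables (K : fieldType) (charK : [pchar K] =i pred0).
Implicit Types (lam : K) (p : {poly K}) (P : {poly {poly K}}).

Lemma natr_pchar0_eq0 n : (n%:R == 0 :> K) = (n == 0)%N.
Proof. exact: (proj1 (pcharf0P K) charK n). Qed.

Lemma polyMn_pchar0_eq0 p n : (p *+ n == 0) = (p == 0) || (n == 0)%N.
Proof. by rewrite -mulr_natr -polyC_natr mulf_eq0 polyC_eq0 natr_pchar0_eq0. Qed.

Lemma size_deriv_pchar0 p : size p^`() = (size p).-1.
Proof.
have [szp|szp] := leqP (size p) 1.
  by rewrite (size1_polyC szp) derivC size_polyC size_poly0; case: eqP.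
have p0 : p != 0 by rewrite -size_poly_gt0 ltnW.
apply/eqP; rewrite eqn_leq -ltnS (ltn_predK szp) lt_size_deriv //=.
rewrite leqNgt; apply/negP => ltp'.
have : p^`()`_(size p).-2 = 0 by apply: nth_default; case: (size p) szp ltp' => [|[]].
rewrite coef_deriv (_ : (size p).-2.+1 = (size p).-1); last by case: (size p) szp => [|[]].
move/eqP; rewrite -mulr_natr mulf_eq0 natr_pchar0_eq0 -lead_coefE lead_coef_eq0.
by rewrite (negPf p0); case: (size p) szp => [|[]].
Qed.

(** Half of [2n - {h, .}], where [P] is a polynomial in [e]: it multiplies the
    coefficient of [e^i] by [n - i]. *)
Definition weight_defect n P := P *+ n - 'X * P^`().

Lemma coef_weight_defect n P i : (weight_defect n P)`_i = P`_i *+ n - P`_i *+ i.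
Proof.
by rewrite /weight_defect coefB coefMn coefXM; case: i => [|i] //=; rewrite coef_deriv.
Qed.

Lemma weight_defect_eq0 n P : weight_defect n P = 0 -> P = P`_n *: 'X^n.
Proof.
move=> defP; apply/polyP=> i; rewrite coefZ coefXn.
have [->|ne_in] := eqVneq i n; first by rewrite mulr1.
rewrite mulr0; have := coef_weight_defect n P i; rewrite defP coef0 => /esym/eqP.
case: (ltngtP i n) ne_in => // lt_in _.
  rewrite -mulrnBr ?(ltnW lt_in) // polyMn_pchar0_eq0.
  by rewrite subn_eq0 leqNgt lt_in orbF => /eqP.
rewrite -opprB -mulrnBr ?(ltnW lt_in) // oppr_eq0 polyMn_pchar0_eq0.
by rewrite subn_eq0 leqNgt lt_in orbF => /eqP.
Qed.

Lemma size_weight_defect P : P != 0 -> (size (weight_defect (size P).-1 P) < size P)%N.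
Proof.
move=> P0; rewrite (polySpred P0) ltnS; apply/leq_sizeP => j lej.
rewrite coef_weight_defect; move: lej; rewrite leq_eqVlt => /predU1P[<-|ltj].
  exact: subrr.
by rewrite nth_default ?mul0rn ?subr0 // (polySpred P0).
Qed.

(** The product [ef], as a polynomial in [h], on the surface [C = lam]. *)
Definition efpoly (lam : K) : {poly K} := (lam / 2)%:P - 4^-1 *: 'X^2.

Lemma efpoly_deriv lam : (efpoly lam)^`() = - (2^-1 *: 'X).
Proof.
rewrite /efpoly derivB derivC derivZ derivXn /= sub0r expr1.
congr (- _); rewrite -scaler_nat scalerA; congr (_ *: _).
have two0 : 2 != 0 :> K by rewrite natr_pchar0_eq0.
have four0 : 4 != 0 :> K by rewrite natr_pchar0_eq0.
field; by rewrite two0 four0.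
Qed.

Lemma size_efpoly lam : size (efpoly lam) = 3%N.
Proof.
have sX : size (- (4^-1 *: 'X^2) : {poly K}) = 3%N.
  by rewrite size_polyN size_scale ?size_polyXn // invr_eq0 natr_pchar0_eq0.
by rewrite /efpoly addrC size_polyDl sX // size_polyC; case: eqP.
Qed.

(** Put [g = efpoly lam].  From [g p' = q p] one gets
    [(g p')' = q' p + q p'], so [p] divides [q p'] as well, say [q p' = r p].
    Then [q^2 p = q g p' = g r p], that is [q^2 = r g], and if [p] is not
    constant the degrees make [q] linear and [r] a nonzero constant.  But [g] has
    no linear term and a nonzero constant term, so it is not a constant
    multiple of the square of a linear polynomial. *)
Lemma efpoly_stable_const lam p : lam != 0 -> p != 0 ->
  p %| efpoly lam * p^`() -> p %| (efpoly lam * p^`())^`() -> size p = 1%N.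
Proof.
move=> lam0 p0 /dvdpP[q0 gq] /dvdpP[r0].
rewrite gq derivM => /(canRL (addKr _)).
move: q0 r0 gq => /= q r0 gq dvp.
apply/eqP; rewrite eqn_leq size_poly_gt0 p0 andbT leqNgt.
apply/negP => szp.
set g := efpoly lam in gq.
have g0 : g != 0 by rewrite -size_poly_gt0 size_efpoly.
have p'0 : p^`() != 0.
  by rewrite -size_poly_gt0 size_deriv_pchar0; case: (size p) szp => [|[]].
have q0 : q != 0.
  by apply: contraNneq (mulf_neq0 g0 p'0) => q0; rewrite gq q0 mul0r.
pose r := - q^`() + r0.
have rE : q * p^`() = r * p by rewrite dvp mulrDl mulNr.
have r_0 : r != 0.
  by apply: contraNneq (mulf_neq0 q0 p'0) => r00; rewrite rE r00 mul0r.
have szq : size q = 2%N.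
  have := congr1 (fun s : {poly K} => size s) gq.
  rewrite /= !size_mul // size_deriv_pchar0 size_efpoly.
  by move: szp; move: (size p) (size q) => n m; lia.
have szr : size r = 1%N.
  have := congr1 (fun s : {poly K} => size s) rE.
  rewrite /= !size_mul // size_deriv_pchar0 szq.
  by move: szp; move: (size p) (size r) => n m; lia.
have qq : q ^+ 2 = r * g.
  apply: (mulIf p0); rewrite expr2 -mulrA -gq mulrCA rE; ring.
(* Compare the coefficients of degrees 1 and 0 in q^2 = r g. *)
have := szr; move/eqP/size_poly1P => [c c0 rc].
have qE : q = (q`_0)%:P + q`_1 *: 'X.
  apply/polyP => i; rewrite coefD coefC coefZ coefX.
  case: i => [|[|i]] /=; rewrite ?mulr0 ?mulr1 ?addr0 ?add0r //.
  by rewrite nth_default // szq.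
have q1 : q`_1 != 0 by have := lead_coef_eq0 q; rewrite lead_coefE szq /= => ->.
move: qq; rewrite rc qE /g /efpoly; set a := q`_0; set b := q`_1.
have -> : (a%:P + b *: 'X) ^+ 2 = (a ^+ 2)%:P + (2 * a * b) *: 'X + b ^+ 2 *: 'X^2.
  rewrite -!mul_polyC !polyCM polyC_natr; ring.
rewrite mul_polyC scalerBr => /polyP E.
have := E 1%N; have := E 0%N; rewrite !(coefD, coefN, coefC, coefZ, coefX, coefXn) /=.
rewrite !(mulr0, mulr1, addr0, add0r, subr0) => E0 /eqP.
rewrite oppr0 !mulf_eq0 natr_pchar0_eq0 (negPf q1) orbF /= => /eqP a0.
move: E0; rewrite a0 expr0n /= => /esym/eqP.
by rewrite !mulf_eq0 invr_eq0 natr_pchar0_eq0 (negPf c0) (negPf lam0).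
Qed.
End CharZeroPoly.

(** * Poisson algebras generated by an sl2-triple with [C = lam] *)

Section Sl2Triple.
Variables (K : fieldType) (charK : [pchar K] =i pred0) (lam : K).
Hypothesis lam0 : lam != 0.
Variables (A : poissonAlgType K) (e f h : A).
Implicit Types (p : {poly K}) (P : {poly {poly K}}) (x y : A).

Local Notation ev := (horner_alg h).

(** Its image is the subalgebra generated by the Borel subalgebra [<h, e>]; [h]
    is the inner variable because brackets with [h] only see the degree in
    [e]. *)
Definition borel_eval P : A := (map_poly ev P).[e].
Local Notation E := borel_eval.

Lemma borel_evalD : {morph E : P Q / P + Q}.
Proof. by move=> P Q; rewrite /E rmorphD hornerD. Qed.
Lemma borel_evalM : {morph E : P Q / P * Q}.
Proof. by move=> P Q; rewrite /E rmorphM hornerM. Qed.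
Lemma borel_evalMn n : {morph E : P / P *+ n}.
Proof. by move=> P; rewrite /E rmorphMn hornerMn. Qed.
Lemma borel_evalB : {morph E : P Q / P - Q}.
Proof. by move=> P Q; rewrite /E rmorphB hornerD hornerN. Qed.
Lemma borel_evalC p : E p%:P = ev p.
Proof. by rewrite /E map_polyC hornerC. Qed.
Lemma borel_evalX : E 'X = e.
Proof. by rewrite /E map_polyX hornerX. Qed.
Lemma borel_evalXn n : E 'X^n = e ^+ n.
Proof. by rewrite /E map_polyXn hornerXn. Qed.
Lemma borel_evalZ p P : E (p *: P) = ev p * E P.
Proof. by rewrite -mul_polyC borel_evalM borel_evalC. Qed.

Hypothesis he : pbracket h e = 2 * e.
Hypothesis hf : pbracket h f = - (2 * f).
Hypothesis ef : pbracket e f = h.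
Hypothesis mul_ef : e * f = ev (efpoly lam).
Hypothesis E_inj : forall P, E P = 0 -> P = 0.
Hypothesis e_regular : forall x, e * x = 0 -> x = 0.
Hypothesis gen : forall S : A -> Prop,
  (forall k : K, S k%:A) -> S e -> S f -> S h ->
  (forall x y, S x -> S y -> S (x + y)) ->
  (forall x y, S x -> S y -> S (x * y)) -> forall x, S x.

Lemma exp_e_regular n x : e ^+ n * x = 0 -> x = 0.
Proof.
by elim: n x => [|n IHn] x; rewrite ?expr0 ?mul1r // exprS -mulrA => /e_regular/IHn.
Qed.

(** Since [ef] is a polynomial in [h], one power of [e] absorbs one factor [f]. *)
Lemma clear_denominators x : exists n P, e ^+ n * x = E P.
Proof.
move: x; apply: gen.
- by move=> k; exists 0%N, k%:P%:P; rewrite borel_evalC horner_algC expr0 mul1r.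
- by exists 0%N, 'X; rewrite borel_evalX expr0 mul1r.
- by exists 1%N, (efpoly lam)%:P; rewrite borel_evalC expr1.
- by exists 0%N, 'X%:P; rewrite borel_evalC horner_algX expr0 mul1r.
- move=> x y [n [P xP]] [m [Q yQ]]; exists (n + m)%N, ('X^m * P + 'X^n * Q).
  rewrite borel_evalD !borel_evalM !borel_evalXn -xP -yQ exprD; ring.
- move=> x y [n [P xP]] [m [Q yQ]]; exists (n + m)%N, (P * Q).
  rewrite borel_evalM -xP -yQ exprD; ring.
Qed.

Lemma pbracketx0 x : pbracket x 0 = 0.
Proof. by rewrite -[0](subrr x) pbracketBr !subrr. Qed.

Lemma pbracket_hpoly x p : pbracket x (ev p) = pbracket x h * ev p^`().
Proof.
elim/poly_ind: p => [|p c IHp].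
  by rewrite deriv0 !rmorph0 mulr0 pbracketx0.
rewrite rmorphD rmorphM /= horner_algX horner_algC pbracketDr pbracketA addr0.
rewrite pbracketM IHp derivD derivM derivX derivC addr0 mulr1 rmorphD rmorphM /=.
rewrite horner_algX; ring.
Qed.

Lemma pbracket_h_borel P : pbracket h (E P) = E ('X * P^`()) *+ 2.
Proof.
elim/poly_ind: P => [|P p IHP].
  by rewrite deriv0 mulr0 /E !rmorph0 horner0 mul0rn pbracketx0.
rewrite borel_evalD borel_evalM borel_evalX borel_evalC pbracketDr pbracketM IHP he.
rewrite pbracket_hpoly pbracketxx mul0r addr0 derivD derivM derivX derivC addr0 mulr1.
rewrite !(borel_evalM, borel_evalD, borel_evalX); ring.
Qed.

Lemma pbracket_h_exp_e n : pbracket h (e ^+ n) = (e ^+ n) *+ (n * 2).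
Proof.
rewrite -borel_evalXn pbracket_h_borel derivXn mulrnA; congr (_ *+ 2).
rewrite mulrnAr borel_evalMn; case: n => [|n]; first by rewrite !mulr0n.
by rewrite -exprS.
Qed.

Lemma pchar0_mulr2n_eq0 x : x *+ 2 = 0 -> x = 0.
Proof.
move=> x2; have two0 : 2 != 0 :> K by rewrite natr_pchar0_eq0.
by rewrite -[x]scale1r -(mulVf two0) -scalerA scaler_nat x2 scaler0.
Qed.

Lemma sl2_triple_central : poisson_central A.
Proof.
move=> c; split=> [cC|[k ->] x]; last by rewrite pbracketC pbracketA oppr0.
have [n [P cP]] := clear_denominators c.
(* e^n c has weight 2n, whence c = a(h). *)
have := pbracket_h_borel P; rewrite -cP pbracketM pbracket_h_exp_e.
rewrite [pbracket h c]pbracketC cC oppr0 mulr0 addr0 mulrnA mulrnAl [in LHS]mulrnAl cP.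
move/eqP; rewrite -subr_eq0 -mulrnBl => /eqP/pchar0_mulr2n_eq0.
rewrite -borel_evalMn -borel_evalB => /E_inj/(weight_defect_eq0 charK) PE.
move: cP; rewrite PE borel_evalZ borel_evalXn mulrC; set a := P`_n.
move/eqP; rewrite -subr_eq0 -mulrBl mulrC => /eqP/exp_e_regular/eqP.
rewrite subr_eq0 => /eqP ca.
have : a^`() = 0.
  have := cC e; rewrite ca pbracketC pbracket_hpoly pbracketC he mulNr opprK.
  rewrite -mulrA mulr_natl mulrC -borel_evalC -borel_evalX -borel_evalM.
  move/pchar0_mulr2n_eq0/E_inj/eqP; rewrite mulf_eq0 polyX_eq0 orbF polyC_eq0.
  by move/eqP.
move/(congr1 (fun s : {poly K} => size s)); rewrite /= size_deriv_pchar0 // size_poly0.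
move=> sza; exists a`_0; rewrite ca {1}(size1_polyC (p := a)) ?horner_algC //.
by case: (size a) sza => [|[]].
Qed.

Section Ideal.
Variables (I : A -> Prop) (I_ideal : is_poisson_ideal I).

Let ID x y : I x -> I y -> I (x + y). Proof. by case: I_ideal => -[_ D _] _; exact: D. Qed.
Let IM x y : I y -> I (x * y). Proof. by case: I_ideal => -[_ _ M] _; exact: M. Qed.
Let Ibr x y : I y -> I (pbracket x y). Proof. by case: I_ideal => _; exact. Qed.
Let IN x : I x -> I (- x). Proof. by rewrite -mulN1r; exact: IM. Qed.
Let I2 x : I (x *+ 2) -> I x.
Proof.
have two0 : 2 != 0 :> K by rewrite natr_pchar0_eq0.
move/(IM (2^-1)%:A); rewrite mulr_algl -scaler_nat scalerA mulVf // scale1r.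
exact.
Qed.

(** Descent on the degree in [e]: the weight defect of [P] stays in the ideal
    and has smaller degree, so it is eventually zero, and then [P] is a
    monomial [a(h) e^m], which [f^m] carries into [K[h]]. *)
Lemma ideal_hpoly P : P != 0 -> I (E P) -> exists2 p, p != 0 & I (ev p).
Proof.
have [n] := ubnP (size P); elim: n P => // n IHn P leP P0 IP.
set R := weight_defect (size P).-1 P.
have IR : I (E R).
  apply: I2; rewrite /R /weight_defect borel_evalB borel_evalMn mulrnBl -pbracket_h_borel.
  by apply: ID; [rewrite -mulrnA -mulr_natl; apply: IM | apply/IN/Ibr].
have [R0|R0] := eqVneq R 0; last first.
  by apply: (IHn R) => //; apply: leq_trans (size_weight_defect P0) _.
have PE := weight_defect_eq0 charK R0; set m := (size P).-1 in R0 PE.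
exists (P`_m * efpoly lam ^+ m).
  rewrite mulf_neq0 ?expf_neq0 //; first by rewrite -lead_coefE lead_coef_eq0.
  by rewrite -size_poly_gt0 (size_efpoly charK).
have -> : ev (P`_m * efpoly lam ^+ m) = ev P`_m * (e * f) ^+ m.
  by rewrite mul_ef rmorphM rmorphXn.
rewrite exprMn mulrA -borel_evalXn -borel_evalZ -PE mulrC.
exact: IM.
Qed.

(** [{p(h), e} = 2 p'(h) e] puts [p'(h) e] in the ideal; multiplying it by [f]
    gives the first element, and bracketing it with [f] gives
    [p'(h) h - 2 p''(h) ef], which is [-2 (g p')'(h)] as [g' = -X/2]. *)
Lemma ideal_ef_deriv p : I (ev p) ->
  I (ev (efpoly lam * p^`())) /\ I (ev (efpoly lam * p^`())^`()).
Proof.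
move=> Ip; have Ip'e : I (ev p^`() * e).
  apply: I2; move/(Ibr e)/IN: Ip; rewrite pbracket_hpoly pbracketC he.
  by rewrite mulNr opprK -mulrA mulr_natl mulrC.
split.
  have -> : ev (efpoly lam * p^`()) = f * (ev p^`() * e).
    by rewrite rmorphM /= -mul_ef; ring.
  exact: IM.
apply: I2; move/(Ibr f): Ip'e.
rewrite pbracketM pbracket_hpoly (pbracketC f h) hf (pbracketC f e) ef opprK.
have -> : ev (efpoly lam * p^`())^`() = e * f * ev p^`()^`() - 2^-1 *: (h * ev p^`()).
  rewrite mul_ef derivM efpoly_deriv // rmorphD !rmorphM rmorphN /=.
  by rewrite [ev (_ *: _)]linearZ /= horner_algX mulNr -scalerAl mul1r -scalerAl addrC.
have two0 : 2 != 0 :> K by rewrite natr_pchar0_eq0.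
rewrite mulrnBl scalerMnl -[2^-1 *+ 2]mulr_natr mulVf // scale1r.
congr I; ring.
Qed.

(** Descent on the degree of [p]: either a remainder modulo [p] gives a smaller
    nonzero element of the ideal, or [p] divides [g p'] and [(g p')'] and is
    constant. *)
Lemma hpoly_ideal1 p : p != 0 -> I (ev p) -> I 1.
Proof.
have [n] := ubnP (size p); elim: n p => // n IHn p lep p0 Ip.
have red q : I (ev q) -> p %| q \/ I 1.
  move=> Iq; have [|r0] := eqVneq (q %% p) 0; first by move/eqP; left.
  right; apply: (IHn (q %% p)) => //.
    by apply: (@leq_trans (size p)); rewrite ?ltn_modp.
  have -> : q %% p = q - (q %/ p) * p by rewrite {2}(divp_eq q p) addrC addKr.
  by rewrite rmorphB rmorphM; apply: ID => //; apply/IN/IM.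
have [/red[] // d1 /red[] // d2] := ideal_ef_deriv Ip.
have /eqP/size_poly1P[c c0 pc] := efpoly_stable_const charK lam0 p0 d1 d2.
move/(IM (c^-1)%:A): Ip; rewrite pc horner_algC mulr_algl scalerA mulVf //.
by rewrite scale1r.
Qed.
End Ideal.

Lemma sl2_triple_simple : poisson_simple A.
Proof.
move=> I I_ideal; have [I0|] := pselect (forall x, I x -> x = 0).
  by left=> x; split=> [/I0|->] //; case: I_ideal => -[].
move=> /existsNP[x /not_implyP[Ix x0]]; right=> y.
have IM : forall x y, I y -> I (x * y) by case: I_ideal => -[].
have [n [P xP]] := clear_denominators x.
have P0 : P != 0.
  apply/eqP=> P0; apply: x0; apply: (@exp_e_regular n); rewrite xP P0.
  by rewrite /E rmorph0 horner0.
have IP : I (E P) by rewrite -xP; apply: IM.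
have [p p0 Ip] := ideal_hpoly I_ideal P0 IP.
by rewrite -[y]mulr1; apply/IM/(hpoly_ideal1 I_ideal p0 Ip).
Qed.
End Sl2Triple.

(** * The ring [K[e,f,h]] modulo [C - lam] *)

Section Presentation.
Variables (K : fieldType).
Implicit Types (p q : Psl2 K) (lam : K).
Local Notation e := (sl2e K).
Local Notation f := (sl2f K).
Local Notation h := (sl2h K).

Lemma sl2_generated (S : Psl2 K -> Prop) :
  (forall k : K, S k%:A) -> S e -> S f -> S h ->
  (forall p q, S p -> S q -> S (p + q)) ->
  (forall p q, S p -> S q -> S (p * q)) -> forall p, S p.
Proof.
move=> SC Se Sf Sh SD SM.
have S1 : S 1 by have := SC 1; rewrite scale1r.
elim/mpolyind => [|c m p _ _ Sp]; first by have := SC 0; rewrite scale0r.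
apply: (SD) => //; rewrite -[_ *: _]mul1r -scalerAr scalerAl; apply: (SM) => //.
rewrite mpolyXE_id; elim/big_ind: _ => // i _.
have SX : S 'X_i by case: i => [[|[|[|]]]].
by elim: (m i) => [|k IHk]; rewrite ?expr0 // exprS; apply: SM.
Qed.

Section Eval.
Variables (R : comNzRingType) (c : {rmorphism K -> R}) (x y z : R).
Definition sl2_eval (p : Psl2 K) : R := mmap c (fun i : 'I_3 => [:: x; y; z]`_i) p.

Lemma sl2_evalD : {morph sl2_eval : p q / p + q}.
Proof. exact: raddfD. Qed.
Lemma sl2_evalB : {morph sl2_eval : p q / p - q}.
Proof. exact: raddfB. Qed.
Lemma sl2_evalM : {morph sl2_eval : p q / p * q}.
Proof. by move=> p q; rewrite /sl2_eval rmorphM. Qed.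
Lemma sl2_evalZ k p : sl2_eval (k *: p) = c k * sl2_eval p.
Proof. exact: mmapZ. Qed.
Lemma sl2_evalA k : sl2_eval k%:A = c k.
Proof. by rewrite sl2_evalZ /sl2_eval rmorph1 mulr1. Qed.
Lemma sl2_eval_e : sl2_eval e = x.
Proof. by rewrite /sl2_eval mmapX mmap1U. Qed.
Lemma sl2_eval_f : sl2_eval f = y.
Proof. by rewrite /sl2_eval mmapX mmap1U. Qed.
Lemma sl2_eval_h : sl2_eval h = z.
Proof. by rewrite /sl2_eval mmapX mmap1U. Qed.
Lemma sl2_eval_casimir lam :
  sl2_eval (sl2_casimir - lam%:A) = c 2^-1 * z ^+ 2 + c 2 * (x * y) - c lam.
Proof.
rewrite /sl2_casimir sl2_evalB sl2_evalA sl2_evalD !sl2_evalZ expr2 !sl2_evalM.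
by rewrite sl2_eval_e sl2_eval_f sl2_eval_h.
Qed.
End Eval.

Hypothesis charK : [pchar K] =i pred0.

(** Setting [e = 0] in [e p = q (C - lam)] gives [q(0,f,h) (h^2/2 - lam) = 0],
    so [q] vanishes at [e = 0] and is divisible by [e], which can be
    cancelled. *)
Lemma sl2e_regular lam p q : e * p = q * (sl2_casimir - lam%:A) ->
  exists q', p = q' * (sl2_casimir - lam%:A).
Proof.
pose s := sl2_eval (@mpolyC 3 K) 0 f h : Psl2 K -> Psl2 K.
have modE r : exists r', r - s r = e * r'.
  move: r; apply: sl2_generated.
  - by move=> k; exists 0; rewrite /s sl2_evalA mulr0 alg_mpolyC subrr.
  - by exists 1; rewrite /s sl2_eval_e subr0 mulr1.
  - by exists 0; rewrite /s sl2_eval_f mulr0 subrr.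
  - by exists 0; rewrite /s sl2_eval_h mulr0 subrr.
  - move=> p1 p2 [r1 e1] [r2 e2]; exists (r1 + r2).
    by rewrite /s sl2_evalD opprD addrACA e1 e2 mulrDr.
  - move=> p1 p2 [r1 e1] [r2 e2]; exists (p1 * r2 + r1 * s p2).
    rewrite mulrDr mulrCA -e2 mulrA -e1 /s sl2_evalM; ring.
move=> epq.
have sC : s (sl2_casimir - lam%:A) = 2^-1 *: h ^+ 2 - lam%:A.
  by rewrite /s sl2_eval_casimir mul0r mulr0 addr0 mul_mpolyC alg_mpolyC.
have sC0 : (2^-1 *: h ^+ 2 - lam%:A : {mpoly K[3]}) != 0.
  apply/eqP => /(congr1 (sl2_eval (@polyC K) 0 0 'X)).
  rewrite sl2_evalB !sl2_evalZ expr2 sl2_evalM sl2_eval_h /sl2_eval rmorph1 raddf0.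
  rewrite mulr1 -expr2 mul_polyC => /polyP/(_ 2%N).
  rewrite coefB coefZ coefXn coefC coef0 /= subr0 mulr1 => /eqP.
  by rewrite invr_eq0 natr_pchar0_eq0.
have sq : s q = 0.
  have := congr1 s epq; rewrite /s !sl2_evalM sl2_eval_e mul0r -/s sC => /esym/eqP.
  by rewrite mulf_eq0 (negPf sC0) orbF => /eqP.
have [q' qE] := modE q; exists q'.
have e0 : (e : {mpoly K[3]}) != 0.
  apply/eqP => /(congr1 (sl2_eval (@polyC K) 'X 0 0)).
  by rewrite sl2_eval_e /sl2_eval raddf0 => /eqP; rewrite polyX_eq0.
by apply: (mulfI e0); rewrite epq mulrA -qE sq subr0.
Qed.

(** Viewed in [K[h][e][f]], the element [C - lam] has degree 1 in [f], so none of
    its nonzero multiples is free of [f]. *)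
Lemma casimir_borel_eq0 lam P q :
  borel_eval e h P = q * (sl2_casimir - lam%:A) -> P = 0.
Proof.
(* From the inside out, the variables of the target are h, e and f. *)
pose phi := sl2_eval (polyC \o polyC \o polyC) 'X%:P 'X 'X%:P%:P
  : Psl2 K -> {poly {poly {poly K}}}.
have phiP : phi (borel_eval e h P) = P%:P.
  have phip (p : {poly K}) : phi (horner_alg h p) = p%:P%:P.
    elim/poly_ind: p => [|p c IHp]; first by rewrite /phi /sl2_eval !raddf0.
    rewrite rmorphD rmorphM /= horner_algX horner_algC.
    rewrite /phi sl2_evalD sl2_evalM sl2_evalA sl2_eval_h -/phi IHp.
    by rewrite !polyCD !polyCM.
  elim/poly_ind: P => [|P p IHP].
    by rewrite /borel_eval /phi /sl2_eval raddf0 horner0 !raddf0.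
  rewrite borel_evalD borel_evalM borel_evalX borel_evalC.
  rewrite /phi sl2_evalD sl2_evalM sl2_eval_e -/phi IHP phip.
  by rewrite polyCD polyCM.
move=> /(congr1 phi); rewrite phiP /phi sl2_evalM sl2_eval_casimir -/phi /=.
set T := (X in _ * X); have szT : size T = 2%N.
  have -> : T = ((2 : K)%:P%:P * 'X)%:P * 'X + (2^-1%:P%:P * 'X%:P ^+ 2 - lam%:P%:P)%:P.
    by rewrite /T !(polyCD, polyCN, polyCM); ring.
  have B0 : (2 : K)%:P%:P * 'X != 0 :> {poly {poly K}}.
    by rewrite mulf_eq0 !polyC_eq0 polyX_eq0 natr_pchar0_eq0.
  by rewrite size_MXaddC polyC_eq0 (negPf B0) /= size_polyC B0.
have [-> | q0 PE] := eqVneq (phi q) 0.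
  by rewrite mul0r => /eqP; rewrite polyC_eq0 => /eqP.
have T0 : T != 0 by rewrite -size_poly_gt0 szT.
have := congr1 (fun r : {poly {poly {poly K}}} => size r) PE.
rewrite /= size_mul // szT size_polyC addn2 /= => sz.
have : (0 < size (phi q))%N by rewrite size_poly_gt0.
by move: sz; case: eqP => //= _ [<-].
Qed.
End Presentation.

(** * The quotient as an algebra generated by an sl2-triple *)

Section Quotient.
Variables (K : fieldType) (charK : [pchar K] =i pred0) (lam : K).
Local Notation I := (casimir_ideal charK lam).
Local Notation Q := {ideal_quot I}.
Local Notation e := (\pi_Q (sl2e K)).
Local Notation f := (\pi_Q (sl2f K)).
Local Notation h := (\pi_Q (sl2h K)).

Lemma quot_eq0P (p : Psl2 K) :
  \pi_Q p = 0 <-> exists q, p = q * (sl2_casimir - lam%:A).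
Proof.
rewrite -(rmorph0 \pi_Q); split=> [/eqP|Ip].
  by rewrite -Quotient.idealrBE subr0 => /asboolP.
by apply/eqP; rewrite -Quotient.idealrBE subr0; apply/asboolP.
Qed.

Lemma quot_piA (k : K) : \pi_Q k%:A = k%:A.
Proof. by rewrite quot_piZ rmorph1. Qed.

Lemma pi_hpoly (p : {poly K}) : \pi_Q (horner_alg (sl2h K) p) = horner_alg h p.
Proof.
elim/poly_ind: p => [|p c IHp]; first by rewrite !rmorph0.
by rewrite !rmorphD !rmorphM /= IHp !horner_algX !horner_algC quot_piA.
Qed.

Lemma pi_borel (P : {poly {poly K}}) :
  \pi_Q (borel_eval (sl2e K) (sl2h K) P) = borel_eval e h P.
Proof.
elim/poly_ind: P => [|P p IHP]; first by rewrite /borel_eval !rmorph0 !horner0 rmorph0.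
rewrite !borel_evalD !borel_evalM !borel_evalX !borel_evalC.
by rewrite rmorphD rmorphM /= IHP pi_hpoly.
Qed.

Lemma quot_he : pbracket h e = 2 * e :> Q.
Proof. by rewrite -pi_pbracket [pbracket _ _]sl2_pbracket_he rmorphM rmorph_nat. Qed.

Lemma quot_hf : pbracket h f = - (2 * f) :> Q.
Proof. by rewrite -pi_pbracket [pbracket _ _]sl2_pbracket_hf rmorphN rmorphM rmorph_nat. Qed.

Lemma quot_ef : pbracket e f = h :> Q.
Proof. by rewrite -pi_pbracket [pbracket _ _]sl2_pbracket_ef. Qed.

Lemma quot_mul_ef : e * f = horner_alg h (efpoly lam) :> Q.
Proof.
rewrite -pi_hpoly -rmorphM; apply/eqP; rewrite -subr_eq0 -rmorphB; apply/eqP/quot_eq0P.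
(* ef - g(h) is one half of C - lam. *)
exists (2^-1)%:A; rewrite /efpoly rmorphB /= horner_algC linearZ /= rmorphXn /= horner_algX.
have two0 : 2 != 0 :> K by rewrite natr_pchar0_eq0.
rewrite !mulr_algl /sl2_casimir scalerBr scalerDr !scalerA mulVf // scale1r.
rewrite -invfM -natrM [_ * lam]mulrC.
by rewrite opprB addrA [_ + _ *: _]addrC.
Qed.

Lemma quot_e_regular (x : Q) : e * x = 0 -> x = 0.
Proof.
rewrite -[x]reprK -rmorphM => /quot_eq0P[q epq].
by apply/quot_eq0P/(sl2e_regular charK epq).
Qed.

Lemma quot_borel_inj (P : {poly {poly K}}) : borel_eval e h P = 0 -> P = 0.
Proof. by rewrite -pi_borel => /quot_eq0P[q /(casimir_borel_eq0 charK)]. Qed.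

Lemma quot_generated (S : Q -> Prop) :
  (forall k : K, S k%:A) -> S e -> S f -> S h ->
  (forall x y, S x -> S y -> S (x + y)) ->
  (forall x y, S x -> S y -> S (x * y)) -> forall x, S x.
Proof.
move=> SC Se Sf Sh SD SM x; rewrite -[x]reprK; move: (repr x).
apply: sl2_generated => //.
- by move=> k; rewrite quot_piA.
- by move=> p q; rewrite rmorphD; apply: SD.
- by move=> p q; rewrite rmorphM; apply: SM.
Qed.
End Quotient.

Theorem corollary1 (K : fieldType) (charK : [pchar K] =i pred0)
    (lam : K) (lam_neq0 : lam != 0) :
  poisson_central {ideal_quot (casimir_ideal charK lam)} /\
  poisson_simple {ideal_quot (casimir_ideal charK lam)}.
Proof.
split.
  exact: (sl2_triple_central charK (quot_he charK lam) (quot_mul_ef charK lam)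
    (@quot_borel_inj _ charK lam) (@quot_e_regular _ charK lam)
    (@quot_generated _ charK lam)).
exact: (sl2_triple_simple charK lam_neq0 (quot_he charK lam) (quot_hf charK lam)
  (quot_ef charK lam) (quot_mul_ef charK lam)
  (@quot_e_regular _ charK lam) (@quot_generated _ charK lam)).
Qed.
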